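(* Let $G$ be a simple, finite, connected graph and $\{F_1,\ldots,F_k\}$ a c-partition of $E(G)$; let $G_i=G/F_i$. Let $w:V(G)\to[0,\infty)$ be a vertex-weight and $w',\lambda':E(G)\to[0,\infty)$ edge-weights, and define on $G_i$: $w_i(X)=\sum_{x\in V(X)}w(x)$ and $\lambda_i(X)=\sum_{f\in E(X)}\lambda'(f)$ for $X\in V(G_i)$, and $w_i'(E)=\sum_{f\in\widehat{E}}w'(f)$, $\lambda_i'(E)=\sum_{f\in\widehat{E}}\lambda'(f)$ for $E\in E(G_i)$. Then $$Sz(G,w,w')=\sum_{i=1}^kSz(G_i,w_i,w_i'),\qquad PI_v(G,w,w')=\sum_{i=1}^kPI_v(G_i,w_i,w_i'),$$ $$Sz_e(G,\lambda',w')=\sum_{i=1}^kSz_t(G_i,\lambda_i,\lambda_i',w_i'),\qquad PI(G,\lambda',w')=\sum_{i=1}^k\big(PI_v(G_i,\lambda_i,w_i')+PI(G_i,\lambda_i',w_i')\big).$$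
   Context: $d_H$ is shortest-path distance; for vertex $u$ and edge $f=xy$, $d_H(u,f)=\min\{d_H(u,x),d_H(u,y)\}$. For an edge $e=uv$ of $H$: $N_u(e|H)=\{x: d_H(u,x)<d_H(v,x)\}$, $M_u(e|H)=\{f\in E(H): d_H(u,f)<d_H(v,f)\}$. For vertex-weight $w$ and edge-weight $\lambda'$: $n_u(e|(H,w))=\sum_{x\in N_u(e|H)}w(x)$, $m_u(e|(H,\lambda'))=\sum_{f\in M_u(e|H)}\lambda'(f)$; similarly for $v$. For a connected graph $H$ with vertex-weight $w$ and edge-weights $\lambda',w'$: $Sz(H,w,w')=\sum_{e=uv\in E(H)}w'(e)\,n_u(e|(H,w))\,n_v(e|(H,w))$; $PI_v(H,w,w')=\sum_{e=uv}w'(e)\big(n_u(e|(H,w))+n_v(e|(H,w))\big)$; $Sz_e(H,\lambda',w')=\sum_{e=uv}w'(e)\,m_u(e|(H,\lambda'))\,m_v(e|(H,\lambda'))$; $PI(H,\lambda',w')=\sum_{e=uv}w'(e)\big(m_u(e|(H,\lambda'))+m_v(e|(H,\lambda'))\big)$; $Sz_t(H,w,\lambda',w')=\sum_{e=uv}w'(e)\big(n_u(e|(H,w))+m_u(e|(H,\lambda'))\big)\big(n_v(e|(H,w))+m_v(e|(H,\lambda'))\big)$. Djoković–Winkler relation $\Theta$: $u_1v_1\,\Theta\,u_2v_2$ iff $d(u_1,u_2)+d(v_1,v_2)\neq d(u_1,v_2)+d(u_2,v_1)$; $\Theta^*$ its transitive closure. A c-partition of $E(G)$ is a partition each of whose parts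 is a union of $\Theta^*$-classes. $G/F$: vertices are the connected components of $G\setminus F$ (edges of $F$ deleted), two components adjacent if some vertex of one is adjacent in $G$ to a vertex of the other; for an edge $E=XY$ of $G/F$, $\widehat{E}$ is the set of edges of $G$ joining $X$ and $Y$. *)

(* Defs.v *)
From mathcomp Require Import all_boot all_order all_algebra.

Set Implicit Arguments.
Unset Strict Implicit.
Unset Printing Implicit Defensive.

Import Order.TTheory GRing.Theory Num.Theory.
Local Open Scope ring_scope.

(* A simple finite graph is given by its adjacency relation [adj] on a        *)
(* finType of vertices (symmetry and irreflexivity are hypotheses of the      *)
(* theorem).  An edge xy is the two-element set [set x; y]; an edge-weight is *)
(* a function on {set T}, of which only the values on [edges adj] are used.   *)

Section Graph.

Variables (T : finType) (adj : rel T).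

Definition edges : {set {set T}} :=
  [set f : {set T} | [exists x, exists y, adj x y && (f == [set x; y])]].

Definition connected_graph : Prop := forall x y, connect adj x y.

Definition walk_of_length (x y : T) (n : nat) : bool :=
  [exists p : n.-tuple T, path adj x p && (last x p == y)].

(* A shortest path has fewer than #|T| edges, so the search range suffices;   *)
(* the value is #|T| when y is not reachable from x.                          *)
Definition dist (x y : T) : nat := find (walk_of_length x y) (iota 0 #|T|).

(* [dist] never exceeds #|T|, so the default of the minimum is harmless.      *)
Definition dist_edge (u : T) (f : {set T}) : nat :=
  \big[minn/#|T|]_(x in f) dist u x.

(* In both definitions v is the end of e other than u.                        *)
Definition closer_vertices (u : T) (e : {set T}) : {set T} :=
  [set x | [exists v, (e == [set u; v]) && (dist u x < dist v x)%N]].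

Definition closer_edges (u : T) (e : {set T}) : {set {set T}} :=
  [set f in edges |
    [exists v, (e == [set u; v]) && (dist_edge u f < dist_edge v f)%N]].

Definition Theta : rel {set T} := [rel f g |
  [&& f \in edges, g \in edges &
    [exists u1, exists v1, exists u2, exists v2,
      [&& f == [set u1; v1], g == [set u2; v2] &
          (dist u1 u2 + dist v1 v2 != dist u1 v2 + dist u2 v1)%N]]]].

(* [connect] is the reflexive-transitive closure; Theta is already reflexive  *)
(* on edges, so on [edges] this is the transitive closure of Theta.           *)
Definition Theta_star : rel {set T} := connect Theta.

Definition Theta_star_classes : {set {set {set T}}} :=
  equivalence_partition Theta_star edges.

Definition c_partition (P : {set {set {set T}}}) : Prop :=
  partition P edges /\
  forall F, F \in P ->
    exists2 C : {set {set {set T}}}, C \subset Theta_star_classes & F = cover C.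

Section Indices.

Variable R : realFieldType.

Definition n_ (w : T -> R) (u : T) (e : {set T}) : R :=
  \sum_(x in closer_vertices u e) w x.

Definition m_ (la' : {set T} -> R) (u : T) (e : {set T}) : R :=
  \sum_(f in closer_edges u e) la' f.

(* For an edge e = uv, sums and products over (x in e) have exactly the two   *)
(* terms x = u and x = v.                                                     *)

Definition Sz (w : T -> R) (w' : {set T} -> R) : R :=
  \sum_(e in edges) w' e * \prod_(u in e) n_ w u e.

Definition PI_v (w : T -> R) (w' : {set T} -> R) : R :=
  \sum_(e in edges) w' e * \sum_(u in e) n_ w u e.

Definition Sz_e (la' w' : {set T} -> R) : R :=
  \sum_(e in edges) w' e * \prod_(u in e) m_ la' u e.

Definition PI (la' w' : {set T} -> R) : R :=
  \sum_(e in edges) w' e * \sum_(u in e) m_ la' u e.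

Definition Sz_t (w : T -> R) (la' w' : {set T} -> R) : R :=
  \sum_(e in edges) w' e * \prod_(u in e) (n_ w u e + m_ la' u e).

End Indices.

Section Quotient.

Variable F : {set {set T}}.

Definition del_edges : rel T := [rel x y | adj x y && ([set x; y] \notin F)].

Definition components : {set {set T}} :=
  equivalence_partition (connect del_edges) [set: T].

(* A component of G \ F, as a vertex of G/F, is represented by its vertex set. *)
Definition component : finType := {X : {set T} | X \in components}.

Definition verts (X : component) : {set T} := sval X.

Definition quot_adj : rel component := fun X Y =>
  (X != Y) && [exists x in verts X, exists y in verts Y, adj x y].

Definition component_edges (X : component) : {set {set T}} :=
  [set f in edges :\: F | f \subset verts X].

Definition hat (E : {set component}) : {set {set T}} :=
  [set f in edges |
    [exists X, exists Y, (E == [set X; Y]) &&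
      [exists x in verts X, exists y in verts Y, f == [set x; y]]]].

Variable R : realFieldType.

Definition quot_w (w : T -> R) (X : component) : R := \sum_(x in verts X) w x.

Definition quot_la (la' : {set T} -> R) (X : component) : R :=
  \sum_(f in component_edges X) la' f.

Definition quot_ew (w' : {set T} -> R) (E : {set component}) : R :=
  \sum_(f in hat E) w' f.

End Quotient.

End Graph.

Arguments quot_adj {T} adj F X Y.
Arguments quot_w {T} adj F {R} w X.
Arguments quot_la {T} adj F {R} la' X.
Arguments quot_ew {T} adj F {R} w' E.

(* Main.v *)
(* Let F be a union of Theta*-classes.  For an edge st, the function
   b |-> d(s,b) - d(t,b) changes along an edge ab only if st Theta ab.  Summing
   these functions over the F-edges st of a geodesic P from x to y gives a
   potential that varies by 2|P /\ F| from x to y, is constant along edges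
   outside F, and varies by at most 2 along an edge of F (the full sum over P
   telescopes to d(x,b) - d(y,b)).  Hence a geodesic has the fewest F-edges among
   all walks with its ends, and that number is the distance D in G/F between the
   components of x and y.  Applying this to F and to its complement shows that
   d and D vary equally along an edge of F.  So, for e in F, being closer to one
   end of e means the same in G as in G/F, for vertices and for edges, and the
   sums over F regroup according to the components and the edges of G/F. *)

Require Import Defs.
From mathcomp Require Import all_boot all_order all_algebra.
From mathcomp Require Import zify.

Set Implicit Arguments.
Unset Strict Implicit.
Unset Printing Implicit Defensive.

Import Order.TTheory GRing.Theory Num.Theory.
Local Open Scope ring_scope.

(** Makes the existentially quantified other end in [closer_vertices] and [closer_edges] unique. *)
Lemma set2_inj (T : finType) (u v v' : T) : [set u; v] = [set u; v'] -> v = v'.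
Proof.
move=> E; have: v \in [set u; v'] by rewrite -E set22.
rewrite !inE => /orP[/eqP vu|/eqP //].
have: v' \in [set u; v] by rewrite E set22.
by rewrite vu !inE orbb => /eqP.
Qed.

(** * Distances, geodesics and crossings of an edge set *)

Section Distance.

Variables (T : finType) (adj : rel T).

Local Notation d := (dist adj).

Lemma edgesP (f : {set T}) :
  reflect (exists x y, adj x y /\ f = [set x; y]) (f \in edges adj).
Proof.
rewrite inE; apply: (iffP existsP) => [[x /existsP[y /andP[xy /eqP ->]]]|].
  by exists x, y.
by move=> [x [y [xy ->]]]; exists x; apply/existsP; exists y; rewrite xy eqxx.
Qed.

Lemma adj_edges x y : adj x y -> [set x; y] \in edges adj.
Proof. by move=> xy; apply/edgesP; exists x, y. Qed.

Lemma dist_le x p : path adj x p -> (d x (last x p) <= size p)%N.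
Proof.
move=> xp; rewrite /dist; have [p_lt|p_ge] := ltnP (size p) #|T|; last first.
  by apply: leq_trans (find_size _ _) _; rewrite size_iota.
rewrite leqNgt; apply/negP => /(before_find 0%N).
rewrite nth_iota // add0n => /negbT/negP; apply.
by apply/existsP; exists (in_tuple p); rewrite /= xp eqxx.
Qed.

Lemma geodesic_exists x y : connect adj x y ->
  exists p, [/\ path adj x p, last x p = y & size p = d x y].
Proof.
move=> /connectP[p xp ->]; case/shortenP: xp => q xq uq _.
set y' := last x q.
(* The shortened path [q] repeats no vertex, so its length is below [#|T|] and the search
   succeeds. *)
have hw : has (walk_of_length adj x y') (iota 0 #|T|).
  apply/hasP; exists (size q); last first.
    by apply/existsP; exists (in_tuple q); rewrite /= xq eqxx.
  rewrite mem_iota add0n leq0n /=.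
  by have /= <- := card_uniqP uq; exact: max_card.
have find_lt : (find (walk_of_length adj x y') (iota 0 #|T|) < #|T|)%N.
  by move: hw; rewrite has_find size_iota.
have := nth_find 0%N hw; rewrite nth_iota // add0n.
by move=> /existsP[r /andP[xr /eqP lr]]; exists r; rewrite size_tuple.
Qed.

Lemma dist_edge_set2 u x y :
  dist_edge adj u [set x; y] = minn (d u x) (d u y).
Proof.
have dT z : (d u z <= #|T|)%N.
  by apply: leq_trans (find_size _ _) _; rewrite size_iota.
rewrite /dist_edge -minEnat bigminU !bigmin_set1 !minEnat.
by rewrite !(minn_idPl (dT _)).
Qed.

Lemma in_closer_vertices u v x :
  (x \in closer_vertices adj u [set u; v]) = (d u x < d v x)%N.
Proof.
rewrite inE; apply/existsP/idP => [[v' /andP[/eqP/set2_inj <-]]//|lt_uv].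
by exists v; rewrite eqxx.
Qed.

Lemma in_closer_edges u v f : (f \in closer_edges adj u [set u; v]) =
  (f \in edges adj) && (dist_edge adj u f < dist_edge adj v f)%N.
Proof.
rewrite inE; congr andb; apply/existsP/idP => [[v' /andP[/eqP/set2_inj <-]]//|lt_uv].
by exists v; rewrite eqxx.
Qed.

Hypothesis adj_sym : symmetric adj.
Hypothesis adj_conn : connected_graph adj.

Lemma dist_sym x y : d x y = d y x.
Proof.
suff le_d a b : (d a b <= d b a)%N by apply/eqP; rewrite eqn_leq !le_d.
have [p [bp <- <-]] := geodesic_exists (adj_conn b a).
have := rev_path adj b p; rewrite (eq_path (e' := adj)) => [|u v]; last exact: adj_sym.
rewrite bp => /dist_le; rewrite size_rev size_belast.
suff -> : last (last b p) (rev (belast b p)) = b by [].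
by case: p {bp} => //= c p; rewrite rev_cons last_rcons.
Qed.

Lemma dist_triangle x y z : (d x z <= d x y + d y z)%N.
Proof.
have [p [xp <- <-]] := geodesic_exists (adj_conn x y).
have [q [yq <- <-]] := geodesic_exists (adj_conn (last x p) z).
by rewrite -last_cat -size_cat; apply: dist_le; rewrite cat_path xp.
Qed.

Lemma dist_adj x y : adj x y -> (d x y <= 1)%N.
Proof. by move=> xy; have := @dist_le x [:: y]; rewrite /= xy; apply. Qed.

Lemma distxx x : d x x = 0%N.
Proof. by apply/eqP; rewrite -leqn0; exact: (@dist_le x [::]). Qed.

Fixpoint crossings (F : {set {set T}}) x p : nat :=
  if p is y :: p' then (([set x; y] \in F) + crossings F y p')%N else 0%N.

Lemma crossings_cat F x p q :
  crossings F x (p ++ q) = (crossings F x p + crossings F (last x p) q)%N.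
Proof. by elim: p x => //= y p IHp x; rewrite IHp addnA. Qed.

Lemma crossings_compl F x p : path adj x p ->
  (crossings F x p + crossings (edges adj :\: F) x p)%N = size p.
Proof.
elim: p x => //= y p IHp x /andP[xy yp].
by rewrite in_setD (adj_edges xy) -(IHp _ yp); case: (_ \in F) => /=; lia.
Qed.

(* The edges of F are not in relation Theta with the edges outside F. *)
Definition theta_closed (F : {set {set T}}) : Prop :=
  forall u v a b, adj u v -> adj a b ->
    [set u; v] \in F -> [set a; b] \notin F ->
    (d u a + d v b = d u b + d v a)%N.

(** The distance identity is symmetric in its two edges, so [F] and its complement exchange
    roles. *)
Lemma theta_closed_compl F : theta_closed F -> theta_closed (edges adj :\: F).
Proof.
move=> Fcl u v a b uv ab; rewrite !in_setD !adj_edges // !andbT negbK => uvF abF.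
have := Fcl a b u v ab uv abF uvF.
by rewrite !(dist_sym a) !(dist_sym b) => ->; rewrite addnC.
Qed.

(** * The potential of a walk and the minimality of geodesics *)

Section Potential.

Variable F : {set {set T}}.
Hypothesis Fcl : theta_closed F.

Fixpoint potential x p b : int :=
  if p is y :: p' then
    (if [set x; y] \in F then (d x b)%:Z - (d y b)%:Z else 0) + potential y p' b
  else 0.

Lemma potential_const x p a b : path adj x p -> adj a b ->
  [set a; b] \notin F -> potential x p a = potential x p b.
Proof.
move=> + ab abF; elim: p x => //= y p IHp x /andP[xy yp]; rewrite (IHp _ yp).
by case: ifP => // xyF; have := Fcl xy ab xyF abF; lia.
Qed.

(** The edges of the walk outside [F] contribute nothing to the change along [ab], so the change is
    that of the sum over all edges of the walk, which telescopes. *)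
Lemma potential_step x p a b : path adj x p -> adj a b -> [set a; b] \in F ->
  potential x p b - potential x p a =
    ((d x b)%:Z - (d (last x p) b)%:Z) - ((d x a)%:Z - (d (last x p) a)%:Z).
Proof.
move=> + ab abF; elim: p x => /= [x _|y p IHp x /andP[xy yp]]; first by lia.
have := IHp _ yp; case: ifPn => [_|xyF]; first by lia.
have := Fcl ab xy abF xyF; rewrite !(dist_sym a) !(dist_sym b); lia.
Qed.

(** A step in [F] changes the distances to [x] and to [last x p] by at most 1 each, hence the
    potential by at most 2; other steps leave it fixed. *)
Lemma potential_walk x p y q : path adj x p -> path adj y q ->
  potential x p (last y q) - potential x p y <= (crossings F y q).*2%:Z.
Proof.
move=> xp; elim: q y => /= [y _|z q IHq y /andP[yz zq]]; first by lia.
have := IHq _ zq; case: (boolP (_ \in F)) => yzF.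
  have := potential_step xp yz yzF; have := dist_adj yz.
  have := dist_triangle x y z; have := dist_triangle (last x p) z y.
  rewrite (dist_sym z y); lia.
by have := potential_const xp yz yzF; lia.
Qed.

(** The base point [x] stays fixed while [z] advances, which makes the induction work. An [F]-edge
    of the walk adds 1 to the potential at the far end and -1 at [x], hence 2 to the difference. *)
Lemma potential_geodesic x z p : path adj z p ->
  (d x z + size p)%N = d x (last z p) ->
  potential z p (last z p) - potential z p x = (crossings F z p).*2%:Z.
Proof.
elim: p z => //= y p IHp z /andP[zy yp] szp.
have := dist_adj zy; have := dist_triangle x z y; have := dist_le yp.
have := dist_triangle x y (last y p).
have := dist_triangle z y (last y p).
have := dist_triangle x z (last y p).
have := IHp _ yp; rewrite (dist_sym z x) (dist_sym y x).
case: (_ \in F); lia.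
Qed.

(** The potential of [p] is followed along [q]: its total increase is exactly twice the crossings of
    [p] and at most twice those of [q]. *)
Lemma crossings_geodesic_min x p q : path adj x p -> size p = d x (last x p) ->
  path adj x q -> last x q = last x p -> (crossings F x p <= crossings F x q)%N.
Proof.
move=> xp szp xq lq; have := potential_walk xp xq; rewrite lq.
by rewrite potential_geodesic // ?distxx //; lia.
Qed.

End Potential.

End Distance.

(** * The quotient graph, and walks projected to it and lifted from it *)

Section Quotient.

Variables (T : finType) (adj : rel T).
Hypothesis adj_sym : symmetric adj.
Hypothesis adj_irr : irreflexive adj.
Hypothesis adj_conn : connected_graph adj.
Variable F : {set {set T}}.

Local Notation d := (dist adj).
Local Notation adjQ := (quot_adj adj F).
Local Notation D := (dist adjQ).

Lemma del_edges_equivalence : equivalence_rel (connect (del_edges adj F)).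
Proof.
suff del_sym : connect_sym (del_edges adj F).
  move=> x y z; split=> [|xy]; first exact: connect0.
  exact: same_connect.
by apply: sym_connect_sym => x y; rewrite /del_edges /= adj_sym setUC.
Qed.

Lemma components_partition : partition (components adj F) [set: T].
Proof.
apply: equivalence_partitionP => x y z _ _ _; exact: del_edges_equivalence.
Qed.

Lemma pblock_components x : pblock (components adj F) x \in components adj F.
Proof. by apply: pblock_mem; rewrite (cover_partition components_partition) inE. Qed.

Definition proj x : component adj F :=
  exist (fun X => X \in components adj F) _ (pblock_components x).

Lemma in_verts x X : (x \in verts X) = (proj x == X).
Proof.
have [_ triv _] := and3P components_partition.
apply/idP/eqP => [xX|<-].
  by apply: val_inj => /=; apply: (def_pblock triv) xX; exact: (svalP X).
by rewrite /verts /= mem_pblock (cover_partition components_partition) inE.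
Qed.

Lemma proj_surj X : exists x, proj x = X.
Proof.
have [_ _ n0] := and3P components_partition.
have [X0|[x]] := set_0Vmem (verts X).
  by have := svalP X; rewrite -[sval X]/(verts X) X0 (negPf n0).
by rewrite in_verts => /eqP; exists x.
Qed.

Lemma eq_proj x y : (proj x == proj y) = connect (del_edges adj F) x y.
Proof.
rewrite eq_sym -in_verts /verts /= pblock_equivalence_partition ?inE //.
by move=> a b c _ _ _; exact: del_edges_equivalence.
Qed.

Lemma proj_adj_notin x y : adj x y -> [set x; y] \notin F -> proj x = proj y.
Proof. by move=> xy xyF; apply/eqP; rewrite eq_proj connect1 // /del_edges /= xy. Qed.

Lemma quot_adj_lift X Y : adjQ X Y ->
  exists x y, [/\ adj x y, proj x = X & proj y = Y].
Proof.
move=> /andP[_ /existsP[x /andP[xX /existsP[y /andP[yY xy]]]]].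
by exists x, y; split=> //; apply/eqP; rewrite -in_verts.
Qed.

Lemma quot_adj_proj x y : adj x y -> proj x != proj y -> adjQ (proj x) (proj y).
Proof.
move=> xy nxy; rewrite /quot_adj nxy; apply/existsP; exists x.
rewrite in_verts eqxx; apply/existsP; exists y.
by rewrite in_verts eqxx xy.
Qed.

Lemma quot_adj_sym : symmetric adjQ.
Proof.
suff sub X Y : adjQ X Y -> adjQ Y X by move=> X Y; apply/idP/idP; apply: sub.
move=> XY; have [x [y [xy xX yY]]] := quot_adj_lift XY.
move: XY => /andP[nXY _]; rewrite -xX -yY; apply: quot_adj_proj.
  by rewrite adj_sym.
by rewrite xX yY eq_sym.
Qed.

(** Steps inside a component are dropped, and the remaining ones lie in [F]. Only an inequality is
    claimed, since at this stage an edge of [F] may have both ends in one component. *)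
Lemma walk_proj x p : path adj x p -> exists P,
  [/\ path adjQ (proj x) P, last (proj x) P = proj (last x p) &
      (size P <= crossings F x p)%N].
Proof.
elim: p x => [x _|y p IHp x /= /andP[xy yp]]; first by exists [::].
have [P [yP lP sP]] := IHp _ yp.
have [eq_xy|nxy] := eqVneq (proj x) (proj y).
  by exists P; rewrite eq_xy; split=> //; exact: leq_trans sP (leq_addl _ _).
exists (proj y :: P); split=> //=; first by rewrite quot_adj_proj.
have [//|/(proj_adj_notin xy) eq_xy] := boolP (_ \in F).
by rewrite eq_xy eqxx in nxy.
Qed.

Lemma eq_proj_walk x y : proj x = proj y ->
  exists p, [/\ path adj x p, last x p = y & crossings F x p = 0%N].
Proof.
move/eqP; rewrite eq_proj => /connectP[p xp ->]; exists p.
elim: p x xp => //= z p IHp x /andP[/andP[/= xz xzF] zp].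
by have [-> _ ->] := IHp _ zp; rewrite xz (negPf xzF).
Qed.

(** Each quotient edge lifts to an edge of the graph, and consecutive lifts are joined inside a
    component by walks avoiding [F]. *)
Lemma walk_lift x y P : path adjQ (proj x) P -> last (proj x) P = proj y ->
  exists p, [/\ path adj x p, last x p = y & (crossings F x p <= size P)%N].
Proof.
elim: P x => [x _ /= /eq_proj_walk[p [xp lp cp]]|Z P IHP x /= /andP[xZ ZP] lP].
  by exists p; rewrite cp.
have [a [b [ab ax bZ]]] := quot_adj_lift xZ; subst Z.
have [p [xp lp cp]] := eq_proj_walk (esym ax).
have [q [bq lq cq]] := IHP _ ZP lP.
exists (p ++ b :: q).
rewrite cat_path last_cat crossings_cat xp lp cp /= ab bq; split=> //.
exact: leq_add (leq_b1 _) cq.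
Qed.

Lemma quot_connected : connected_graph adjQ.
Proof.
move=> X Y; have [x <-] := proj_surj X; have [y <-] := proj_surj Y.
have /connectP[p xp ->] := adj_conn x y.
by have [P [xP <- _]] := walk_proj xp; apply/connectP; exists P.
Qed.

(** * Distances in the graph against distances in the quotient *)

Section Closed.

Hypothesis Fcl : theta_closed adj F.

(** Otherwise a walk avoiding [F] would join the ends of [uv], against the minimality of the
    geodesic formed by this edge, which crosses [F] once. *)
Lemma proj_neq u v : adj u v -> [set u; v] \in F -> proj u != proj v.
Proof.
move=> uv uvF; apply/eqP => /eq_proj_walk[p [up lp cp]].
have uv1 : path adj u [:: v] by rewrite /= uv.
have duv : 1%N = d u v.
  apply/eqP; rewrite eqn_leq dist_adj // andbT lt0n.
  apply: contraTneq uv => duv0.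
  have [[|a q] [_ /= uq sq]] := geodesic_exists (adj_conn u v).
    by rewrite uq adj_irr.
  by rewrite duv0 in sq.
by have := crossings_geodesic_min adj_sym adj_conn Fcl uv1 duv up lp; rewrite cp /= uvF.
Qed.

(** Projecting the geodesic bounds [D] from above; lifting a quotient geodesic and using minimality
    gives the converse. *)
Lemma crossings_geodesic x p : path adj x p -> size p = d x (last x p) ->
  crossings F x p = D (proj x) (proj (last x p)).
Proof.
move=> xp szp; apply/eqP; rewrite eqn_leq; apply/andP; split; last first.
  have [P [xP <- sP]] := walk_proj xp.
  exact: leq_trans (dist_le xP) sP.
have [P [xP lP <-]] := geodesic_exists (quot_connected (proj x) (proj (last x p))).
have [q [xq lq cq]] := walk_lift xP lP.
apply: leq_trans cq; exact: crossings_geodesic_min.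
Qed.

(* Since the edges outside F form a theta-closed set as well, a step along an
   edge of F does not change the number of crossings outside F of a geodesic. *)
Lemma dist_quot_diff u x y : adj x y -> [set x; y] \in F ->
  (d u x + D (proj u) (proj y) = d u y + D (proj u) (proj x))%N.
Proof.
have E_cl := theta_closed_compl adj_sym adj_conn Fcl.
suff le_d a b : adj a b -> [set a; b] \in F ->
    (d u a + D (proj u) (proj b) <= d u b + D (proj u) (proj a))%N.
  move=> xy xyF; have yx : adj y x by rewrite adj_sym.
  have yxF : [set y; x] \in F by rewrite setUC.
  have le_xy := le_d x y xy xyF; have le_yx := le_d y x yx yxF.
  by apply: anti_leq; apply/andP.
move=> ab abF.
have [p [up lp szp]] := geodesic_exists (adj_conn u a).
have [q [uq lq szq]] := geodesic_exists (adj_conn u b).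
rewrite -{1}lp in szp; rewrite -{1}lq in szq.
have := crossings_geodesic up szp; have := crossings_geodesic uq szq.
have := crossings_compl F up; have := crossings_compl F uq.
(* The geodesic [q] to [b], prolonged by the [F]-edge [ba], reaches [a] with no new crossing outside
   [F], so the geodesic [p] has at most as many such crossings as [q]. *)
have uqa : path adj u (rcons q a) by rewrite rcons_path uq lq adj_sym.
have lqa : last u (rcons q a) = last u p by rewrite last_rcons.
have := crossings_geodesic_min adj_sym adj_conn E_cl up szp uqa lqa.
rewrite -cats1 crossings_cat lq /= setUC in_setD abF /=.
rewrite lp lq in szp szq *; lia.
Qed.

Hypothesis F_edges : F \subset edges adj.

Lemma F_edgesP f : f \in F -> exists x y, [/\ adj x y, f = [set x; y] & f \in F].
Proof.
move=> fF; have /edgesP[x [y [xy fxy]]] := subsetP F_edges _ fF.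
by exists x, y.
Qed.

Lemma imset_proj2 x y : proj @: [set x; y] = [set proj x; proj y].
Proof. by rewrite imsetU !imset_set1. Qed.

(** Allows sums and products over the ends of a quotient edge to be reindexed by the ends of [e]. *)
Lemma proj_inj_F e : e \in F -> {in e &, injective proj}.
Proof.
move=> /F_edgesP[u [v [uv -> uvF]]] x y; have nuv := proj_neq uv uvF.
by rewrite !inE => /orP[] /eqP-> /orP[] /eqP-> // eq_uv; rewrite eq_uv eqxx in nuv.
Qed.

Lemma imset_proj_edges e : e \in F -> proj @: e \in edges adjQ.
Proof.
move=> /F_edgesP[u [v [uv -> uvF]]]; rewrite imset_proj2.
exact: adj_edges (quot_adj_proj uv (proj_neq uv uvF)).
Qed.

(** The two ends of [E] are distinct components, whereas an edge outside [F] has both ends in a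
    single one. *)
Lemma in_hat E f : E \in edges adjQ ->
  (f \in hat E) = (f \in F) && (proj @: f == E).
Proof.
move=> /edgesP[A [B [AB EAB]]]; rewrite inE; apply/idP/idP.
  move=> /andP[/edgesP[a [b [ab ->]]] /existsP[X /existsP[Y /andP[/eqP EXY]]]].
  move=> /existsP[x /andP[xX /existsP[y /andP[yY /eqP fxy]]]].
  have fE : proj @: [set a; b] = E.
    by move: xX yY; rewrite fxy imset_proj2 EXY !in_verts => /eqP-> /eqP->.
  rewrite fE eqxx andbT; apply: contraTT AB => /(proj_adj_notin ab) eq_ab.
  have : A == B; last by rewrite /quot_adj => ->.
  move: fE; rewrite imset_proj2 eq_ab EAB setUid => /setP fE.
  by have := fE A; have := fE B; rewrite !inE !eqxx orbT => /eqP-> /eqP->.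
move=> /andP[fF /eqP <-]; rewrite (subsetP F_edges) //=.
have [x [y [xy -> _]]] := F_edgesP fF.
apply/existsP; exists (proj x); apply/existsP; exists (proj y).
rewrite imset_proj2 eqxx; apply/existsP; exists x; rewrite in_verts eqxx.
by apply/existsP; exists y; rewrite in_verts !eqxx.
Qed.

Lemma dist_lt_proj u v x : adj u v -> [set u; v] \in F ->
  (d u x < d v x)%N = (D (proj u) (proj x) < D (proj v) (proj x))%N.
Proof.
move=> uv uvF; have := dist_quot_diff x uv uvF.
rewrite !(dist_sym adj_sym adj_conn x).
rewrite !(dist_sym quot_adj_sym quot_connected (proj x)); lia.
Qed.

Lemma in_closer_vertices_proj u v x : adj u v -> [set u; v] \in F ->
  (proj x \in closer_vertices adjQ (proj u) (proj @: [set u; v])) =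
  (x \in closer_vertices adj u [set u; v]).
Proof.
by move=> uv uvF; rewrite imset_proj2 !in_closer_vertices dist_lt_proj.
Qed.

(** For [f = xy], the difference between [d] and [D] is the same for all four pairs of an end of
    [uv] and an end of [f], so comparing minima gives the same answer. *)
Lemma in_closer_edges_proj u v f : adj u v -> [set u; v] \in F -> f \in F ->
  (proj @: f \in closer_edges adjQ (proj u) (proj @: [set u; v])) =
  (f \in closer_edges adj u [set u; v]).
Proof.
move=> uv uvF fF; rewrite imset_proj2 !in_closer_edges imset_proj_edges //.
rewrite (subsetP F_edges) //=; have [x [y [xy fxy _]]] := F_edgesP fF.
rewrite fxy in fF *; rewrite imset_proj2 !dist_edge_set2.
have ux := dist_quot_diff u xy fF; have vx := dist_quot_diff v xy fF.
have xu := dist_quot_diff x uv uvF.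
rewrite !(dist_sym adj_sym adj_conn x) in xu.
rewrite !(dist_sym quot_adj_sym quot_connected (proj x)) in xu; lia.
Qed.

(* Only meaningful for an edge outside F, whose ends lie in one component; z is a
   default used only when f is empty. *)
Definition edge_component (z : T) (f : {set T}) : component adj F :=
  proj (odflt z [pick x in f]).

Lemma edge_component_set2 z x y : proj x = proj y ->
  edge_component z [set x; y] = proj x.
Proof.
move=> eq_xy; rewrite /edge_component; case: pickP => [a|/(_ x)]; rewrite !inE ?eqxx //.
by move=> /orP[] /eqP->.
Qed.

Lemma in_component_edges z f X : f \in edges adj -> f \notin F ->
  (f \in component_edges X) = (edge_component z f == X).
Proof.
move=> fE fF; rewrite inE in_setD fF fE /=.
have /edgesP[x [y [xy fxy]]] := fE.
have eq_xy : proj x = proj y by apply: proj_adj_notin; rewrite // -fxy.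
by rewrite fxy (edge_component_set2 _ eq_xy) subUset !sub1set !in_verts -eq_xy andbb.
Qed.

(** Both ends of [f] have the same projection, so [d u - d v] takes the same value at both, and
    comparing the minima amounts to comparing at one end. *)
Lemma in_closer_edges_component z u v f : adj u v -> [set u; v] \in F ->
  f \in edges adj -> f \notin F ->
  (edge_component z f \in closer_vertices adjQ (proj u) (proj @: [set u; v])) =
  (f \in closer_edges adj u [set u; v]).
Proof.
move=> uv uvF fE fF; have /edgesP[x [y [xy fxy]]] := fE.
have eq_xy : proj x = proj y by apply: proj_adj_notin; rewrite // -fxy.
rewrite in_closer_edges fE /= fxy (edge_component_set2 _ eq_xy) in_closer_vertices_proj //.
rewrite in_closer_vertices !dist_edge_set2.
have := dist_quot_diff x uv uvF; have := dist_quot_diff y uv uvF.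
rewrite !(dist_sym adj_sym adj_conn x) !(dist_sym adj_sym adj_conn y) eq_xy; lia.
Qed.

(** * Regrouping weighted sums over the quotient *)

Section Sums.

Variable R : realFieldType.

Lemma n_quot (w : T -> R) u v : adj u v -> [set u; v] \in F ->
  n_ adj w u [set u; v] =
  n_ adjQ (quot_w adj F w) (proj u) (proj @: [set u; v]).
Proof.
move=> uv uvF; rewrite /n_ /quot_w.
rewrite (partition_big proj
  (mem (closer_vertices adjQ (proj u) (proj @: [set u; v])))) => [|x] /=; last first.
  by rewrite in_closer_vertices_proj.
apply: eq_bigr => X XN; apply: eq_bigl => x; rewrite in_verts.
by have [eqX|] := eqVneq (proj x) X; rewrite ?andbF // -in_closer_vertices_proj // eqX XN.
Qed.

Lemma m_quot (la : {set T} -> R) u v : adj u v -> [set u; v] \in F ->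
  m_ adj la u [set u; v] =
  n_ adjQ (quot_la adj F la) (proj u) (proj @: [set u; v]) +
  m_ adjQ (quot_ew adj F la) (proj u) (proj @: [set u; v]).
Proof.
move=> uv uvF; rewrite /m_ /n_ /quot_la /quot_ew.
have closerE f : f \in closer_edges adj u [set u; v] -> f \in edges adj.
  by rewrite in_closer_edges => /andP[].
(* Edges outside [F] are grouped by the component containing them and give the vertex term; edges of
   [F] are grouped by their image and give the edge term. *)
rewrite (bigID (fun f => f \notin F)) /=; congr (_ + _).
  rewrite (partition_big (edge_component u)
    (mem (closer_vertices adjQ (proj u) (proj @: [set u; v])))) => [|f] /=; last first.
    by move=> /andP[fM fF]; rewrite in_closer_edges_component // closerE.
  apply: eq_bigr => X XN; apply: eq_bigl => f; apply/idP/idP.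
    by move=> /andP[/andP[fM fF]]; rewrite -in_component_edges // closerE.
  move=> fX; have := fX; rewrite inE in_setD => /andP[/andP[fF fE] _].
  rewrite fF andbT -(in_closer_edges_component u) // -in_component_edges // fX andbT.
  by move: fX; rewrite (in_component_edges u) // => /eqP ->.
rewrite (partition_big (fun f : {set T} => proj @: f)
  (mem (closer_edges adjQ (proj u) (proj @: [set u; v])))) => [|f] /=; last first.
  by rewrite negbK => /andP[fM fF]; rewrite in_closer_edges_proj.
apply: eq_bigr => E EM; apply: eq_bigl => f; rewrite negbK in_hat; last first.
  by move: EM; rewrite imset_proj2 in_closer_edges => /andP[].
have [fE|] := eqVneq (proj @: f) E; rewrite ?andbF // !andbT.
by have [fF|] := boolP (f \in F); rewrite ?andbF // -in_closer_edges_proj // fE EM.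
Qed.

(** The sets [hat E] are the fibres of the projection on [F], and [phi] is constant on each. All
    four index identities are instances. *)
Lemma sum_quot (w' phi : {set T} -> R) (Phi : {set component adj F} -> R) :
  (forall e, e \in F -> phi e = Phi (proj @: e)) ->
  \sum_(e in F) w' e * phi e =
  \sum_(E in edges adjQ) quot_ew adj F w' E * Phi E.
Proof.
move=> phiE; rewrite (partition_big (fun e : {set T} => proj @: e) (mem (edges adjQ))) /=; last first.
  exact: imset_proj_edges.
apply: eq_bigr => E EE; rewrite mulr_suml; apply: eq_big => e; first by rewrite in_hat.
by move=> /andP[eF /eqP eE]; rewrite phiE // eE.
Qed.

Lemma n_quot_in (w : T -> R) e u : e \in F -> u \in e ->
  n_ adj w u e = n_ adjQ (quot_w adj F w) (proj u) (proj @: e).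
Proof.
move=> /F_edgesP[a [b [ab -> abF]]]; rewrite !inE => /orP[] /eqP->.
  exact: n_quot.
by rewrite setUC; apply: n_quot; rewrite 1?adj_sym 1?setUC.
Qed.

Lemma m_quot_in (la : {set T} -> R) e u : e \in F -> u \in e ->
  m_ adj la u e = n_ adjQ (quot_la adj F la) (proj u) (proj @: e) +
                  m_ adjQ (quot_ew adj F la) (proj u) (proj @: e).
Proof.
move=> /F_edgesP[a [b [ab -> abF]]]; rewrite !inE => /orP[] /eqP->.
  exact: m_quot.
by rewrite setUC; apply: m_quot; rewrite 1?adj_sym 1?setUC.
Qed.

Lemma Sz_quot (w : T -> R) (w' : {set T} -> R) :
  \sum_(e in F) w' e * \prod_(u in e) n_ adj w u e =
  Sz adjQ (quot_w adj F w) (quot_ew adj F w').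
Proof.
apply: sum_quot => e eF; rewrite big_imset; last exact: proj_inj_F.
by apply: eq_bigr => u ue; exact: n_quot_in.
Qed.

Lemma PI_v_quot (w : T -> R) (w' : {set T} -> R) :
  \sum_(e in F) w' e * \sum_(u in e) n_ adj w u e =
  PI_v adjQ (quot_w adj F w) (quot_ew adj F w').
Proof.
apply: sum_quot => e eF; rewrite big_imset; last exact: proj_inj_F.
by apply: eq_bigr => u ue; exact: n_quot_in.
Qed.

Lemma Sz_e_quot (la' w' : {set T} -> R) :
  \sum_(e in F) w' e * \prod_(u in e) m_ adj la' u e =
  Sz_t adjQ (quot_la adj F la') (quot_ew adj F la') (quot_ew adj F w').
Proof.
apply: sum_quot => e eF; rewrite big_imset; last exact: proj_inj_F.
by apply: eq_bigr => u ue; exact: m_quot_in.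
Qed.

Lemma PI_quot (la' w' : {set T} -> R) :
  \sum_(e in F) w' e * \sum_(u in e) m_ adj la' u e =
  PI_v adjQ (quot_la adj F la') (quot_ew adj F w') +
  PI adjQ (quot_ew adj F la') (quot_ew adj F w').
Proof.
(* The two indices are merged into one sum over quotient edges, the form required by [sum_quot]. *)
rewrite /PI_v /PI -big_split /=.
under [RHS]eq_bigr => E _ do rewrite -mulrDr -big_split /=.
apply: sum_quot => e eF; rewrite big_imset; last exact: proj_inj_F.
by apply: eq_bigr => u ue; exact: m_quot_in.
Qed.

End Sums.

End Closed.

End Quotient.

(** * From c-partitions to the four identities *)

Lemma c_partition_theta_closed (T : finType) (adj : rel T)
    (P : {set {set {set T}}}) F :
  symmetric adj -> connected_graph adj ->
  c_partition adj P -> F \in P -> theta_closed adj F.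
Proof.
move=> adj_sym adj_conn [_ P_classes] /P_classes[C C_cl ->] u v a b uv ab.
(* If the identity failed, [u, v, a, b] would witness [Theta] between the two edges, placing [ab] in
   the class [B] of [uv] and hence in the union. *)
move=> /bigcupP[B BC uvB]; apply: contraNeq => neq_d.
apply/bigcupP; exists B => //.
have /imsetP[h hE Bh] := subsetP C_cl _ BC.
have in_B g : (g \in B) = (g \in edges adj) && Theta_star adj h g by rewrite Bh [LHS]in_set.
move: uvB; rewrite !in_B !adj_edges //= => h_uv.
apply: (connect_trans h_uv); apply: connect1; rewrite /Theta /= !adj_edges //=.
apply/existsP; exists u; apply/existsP; exists v.
apply/existsP; exists a; apply/existsP; exists b.
by rewrite !eqxx (dist_sym adj_sym adj_conn a).
Qed.

Theorem theorem3p4 (R : realFieldType) (T : finType) (adj : rel T)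
  (adj_sym : symmetric adj) (adj_irr : irreflexive adj)
  (adj_conn : connected_graph adj)
  (k : nat) (F : 'I_k -> {set {set T}}) (F_inj : injective F)
  (F_cpart : c_partition adj [set F i | i : 'I_k])
  (w : T -> R) (w' la' : {set T} -> R)
  (w_ge0 : forall x, 0 <= w x)
  (w'_ge0 : forall f, f \in edges adj -> 0 <= w' f)
  (la'_ge0 : forall f, f \in edges adj -> 0 <= la' f) :
  let G_ i := quot_adj adj (F i) in
  let w_ i := quot_w adj (F i) w in
  let la_ i := quot_la adj (F i) la' in
  let w'_ i := quot_ew adj (F i) w' in
  let la'_ i := quot_ew adj (F i) la' in
  [/\ Sz adj w w' = \sum_(i < k) Sz (G_ i) (w_ i) (w'_ i),
      PI_v adj w w' = \sum_(i < k) PI_v (G_ i) (w_ i) (w'_ i),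
      Sz_e adj la' w' = \sum_(i < k) Sz_t (G_ i) (la_ i) (la'_ i) (w'_ i) &
      PI adj la' w' =
        \sum_(i < k) (PI_v (G_ i) (la_ i) (w'_ i) + PI (G_ i) (la'_ i) (w'_ i))].
Proof.
move=> G_ w_ la_ w'_ la'_; have [P_part _] := F_cpart.
have FP i : F i \in [set F i | i : 'I_k] by exact: imset_f.
have F_cl i := c_partition_theta_closed adj_sym adj_conn F_cpart (FP i).
have F_edges i : F i \subset edges adj.
  by rewrite -(cover_partition P_part); exact: bigcup_sup (FP i).
have sumE (phi : {set T} -> R) :
    \sum_(e in edges adj) phi e = \sum_(i < k) \sum_(e in F i) phi e.
  (* Injectivity of [F] turns the sum over the set of parts into a sum over indices. *)
  rewrite (set_partition_big _ P_part) big_imset; last by move=> i j _ _; exact: F_inj.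
  by apply: eq_bigl => i; rewrite inE.
split; rewrite [LHS]sumE; apply: eq_bigr => i _.
- exact: Sz_quot.
- exact: PI_v_quot.
- exact: Sz_e_quot.
- exact: PI_quot.
Qed.
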